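(* Let $n$ be a positive integer and $t>0$. If $y_{n,1}(t),\dots,y_{n,n}(t)$ are the $n$ zeros of $Q_n^t(y)$, then $$\frac{\partial y_{n,k}}{\partial t}(t)=\frac{-y_{n,k}^2(t)\,\widetilde{\flat}_{n,n-2}\,\dfrac{b_{n-2}^t}{b_{n-1}^t\,a_{n-1}^2(t)}\,Q_{n-1}^t\left(y_{n,k}(t)\right)}{C_{k,1}(n,t)\,F_n^t\left(y_{n,k}(t)\right)+C_{k,2}(n,t)\,F_{n-1}^t\left(y_{n,k}(t)\right)},$$ where $$C_{k,1}(n,t)=1-4a_n^2(t)\left[b_n^ty_{n,k}^2(t)+(b_n^t-1)\left(a_n^2(t)+a_{n-1}^2(t)-t\right)\right],$$ $$C_{k,2}(n,t)=4a_n^2(t)\,y_{n,k}(t)\left[b_n^t\left(y_{n,k}^2(t)-t+a_n^2(t)\right)+a_{n+1}^2(t)\right],$$ and $$\widetilde{\flat}_{n,n-2}=-\frac{2}{b_{n-2}^t}\left(a_n^2(t)a_{n-1}^2(t)+\frac{M[F_n^t(0)]^2}{\left(1+MK_{n-1}(0,0;t)\right)\|F_{n-2}^t\|_t^2}\right).$$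
   Context: Here $M\in\mathbb{R}_+$ is fixed. For polynomials with real coefficients put $\langle p,q\rangle_t=\int_{\mathbb{R}}p(x)q(x)e^{-x^4+2tx^2}dx$ and $\|p\|_t^2=\langle p,p\rangle_t$. $\{F_n^t\}_{n\geq0}$ is the sequence of monic polynomials ($\deg F_n^t=n$) orthogonal with respect to $\langle\cdot,\cdot\rangle_t$; it satisfies $xF_n^t(x)=F_{n+1}^t(x)+a_n^2(t)F_{n-1}^t(x)$ with $F_{-1}^t=0$, $F_0^t=1$, $a_0^2(t)=0$, and $a_n^2(t)=\|F_n^t\|_t^2/\|F_{n-1}^t\|_t^2>0$ for $n\ge1$. The kernel is $K_n(x,y;t)=\sum_{k=0}^n F_k^t(x)F_k^t(y)/\|F_k^t\|_t^2$ (with $K_{-1}=0$, the empty sum). The Freud-type polynomials $\{Q_n^t\}_{n\geq0}$ are the monic polynomials ($\deg Q_n^t=n$) orthogonal with respect to $\langle p,q\rangle=\langle p,q\rangle_t+Mp(0)q(0)$. Put $b_n^t=\dfrac{1+MK_n(0,0;t)}{1+MK_{n-1}(0,0;t)}$. The quantity $\widetilde{\flat}_{n,n-2}$ is the coefficient in the expansion $\frac{\partial Q_n^t}{\partial t}(y)=\widetilde{\flat}_{n,n-2}\,Q_{n-2}^t(y)$. *)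

(* Defs.v *)
From HB Require Import structures.
From mathcomp Require Import all_boot all_order all_algebra.
From mathcomp Require Import all_classical all_reals all_analysis.

Set Implicit Arguments.
Unset Strict Implicit.
Unset Printing Implicit Defensive.

Import Order.TTheory GRing.Theory Num.Theory.
Import numFieldNormedType.Exports.

Local Open Scope ring_scope.

(* Sequences of polynomials are indexed by int, so that P_(-1) and P_(n-2) with n = 1 are genuine
   entries (equal to 0) and no truncated subtraction occurs. *)

Definition freud_form (R : realType) (t : R) (p q : {poly R}) : R :=
  \int[@lebesgue_measure R]_x (p.[x] * q.[x] * expR (- x ^+ 4 + 2 * t * x ^+ 2)).

Definition freud_type_form (R : realType) (M t : R) (p q : {poly R}) : R :=
  freud_form t p q + M * p.[0] * q.[0].

Definition monic_orthogonal_sequence (R : realType)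
    (form : {poly R} -> {poly R} -> R) (P : int -> {poly R}) : Prop :=
  [/\ forall k : int, k < 0 -> P k = 0,
      forall n : nat, P n \is monic,
      forall n : nat, size (P n) = n.+1
    & forall m n : nat, m <> n -> form (P m) (P n) = 0].

Definition norm2 (R : realType) (t : R) (p : {poly R}) : R := freud_form t p p.

(* a2 t F k is a_k^2(t), the square included. *)
Definition a2 (R : realType) (t : R) (F : int -> {poly R}) (k : int) : R :=
  if 0 < k then norm2 t (F k) / norm2 t (F (k - 1)) else 0.

(* The sum over 0 <= j <= k, hence empty for k < 0. *)
Definition kernel_poly (R : realType) (t : R) (F : int -> {poly R}) (k : int)
    (x y : R) : R :=
  if k is Posz m then
    \sum_(j < m.+1) (F j).[x] * (F j).[y] / norm2 t (F j)
  else 0.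

Definition b (R : realType) (M t : R) (F : int -> {poly R}) (k : int) : R :=
  (1 + M * kernel_poly t F k 0 0) / (1 + M * kernel_poly t F (k - 1) 0 0).

(* z lists the n zeros of the monic polynomial p of degree n, with
   multiplicity.  The labelling is by increasing order: without a fixed
   labelling, a zero need not even be a continuous function of a parameter
   of p.  Simplicity of the zeros is not assumed. *)
Definition ordered_zeros (R : realType) (n : nat) (p : {poly R})
    (z : 'I_n -> R) : Prop :=
  p = \prod_(k < n) ('X - (z k)%:P) /\
  (forall i j : 'I_n, (i <= j)%N -> z i <= z j).

(* Main.v *)
Require Import Defs.
From HB Require Import structures.
From mathcomp Require Import all_boot all_order all_algebra.
From mathcomp Require Import all_classical all_reals all_analysis.
From mathcomp Require Import measurable_realfun.
From mathcomp Require Import ring lra zify.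

Set Implicit Arguments.
Unset Strict Implicit.
Unset Printing Implicit Defensive.

Import Order.TTheory GRing.Theory Num.Theory.
Import numFieldNormedType.Exports.

Local Open Scope ring_scope.

(** * Why the formula holds

    Write [L s p] for the integral of [p] against the weight
    [exp (- x^4 + 2 s x^2)] and [LM s p = L s p + M p(0)]. The two inner
    products are [L s (p q)] and [LM s (p q)], so both orthogonal families
    come from positive functionals that are invariant under [x |-> -x], and
    one general theory (orthogonality against lower degrees, parity, the
    three-term recurrence, simplicity of zeros) serves for both.

    Motion of the polynomials. Differentiating the weight in [s] multiplies it
    by [2 x^2], and [x^2] kills the mass at the origin. Differentiating the
    relation [LM s (Q_n q) = 0], for [q] of degree less than [n], gives
    [LM (Q_n' q) = - 2 LM (Q_n x^2 q)], where the prime is the derivative in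
    [s]. The right side vanishes for [deg q < n - 2], and parity removes
    [n - 1]; hence [Q_n'] is the multiple [- 2 |Q_n|^2 / |Q_(n-2)|^2] of
    [Q_(n-2)] ([ops_two_below]). The norms satisfy [|Q_n|^2 = b_n |F_n|^2]
    ([mass_ops_norm]), which turns this constant into the stated one. That the
    coefficients are differentiable at all follows by induction from the
    Gram-Schmidt formula ([ops_coef_derive]).

    Motion of the zeros. The zeros at time [t] are simple, so the ordered
    zeros are continuous, and factoring
    [Q_n (s, y_k t) = (y_k t - y_k s) * prod_(j <> k) (y_k t - y_j s)]
    yields the derivative [- (d/dt Q_n) (y_k) / (d/dx Q_n) (y_k)]
    ([is_derive_ordered_zeros]).

    Shape of the quotient. At a zero [y] of [Q_n] the recurrence expresses
    [Q_(n-2) (y)] through [y Q_(n-1) (y)], which gives the numerator. For the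
    denominator, [x Q_n = x F_n + (b_n - 1) a_n^2 F_(n-1)]
    ([mass_ops_relation]) is differentiated in [x], and the derivatives of
    [F_n] and [F_(n-1)] are reduced to [F_n] and [F_(n-1)] by the structure
    relations that integration by parts gives for the weight
    ([deriv_ops_raise], [deriv_ops_lower]); the outcome is
    [y (d/dx Q_n) (y) = C_1 F_n (y) + C_2 F_(n-1) (y)]
    ([mass_ops_deriv_at_zero]). When [y = 0] both sides of the formula
    vanish. *)

(** * The Freud weight and its moment functional *)
Section FreudWeight.
Variable R : realType.
Local Notation mu := (@lebesgue_measure R).
Implicit Types (p q : {poly R}) (s x : R).

Definition freud_weight s x : R := expR (- x ^+ 4 + 2 * s * x ^+ 2).

Lemma freud_weightN s x : freud_weight s (- x) = freud_weight s x.
Proof. by rewrite /freud_weight; congr expR; ring. Qed.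

(** The rate [m] may grow with the degree: the quartic in the exponent of the
    weight absorbs any multiple of [x^2], so induction on the polynomial with
    [|x| <= exp (x^2)] is enough. *)
Lemma poly_le_expR_sqr p : exists2 A : R, 0 <= A &
  exists m : nat, forall x, `|p.[x]| <= A * expR (m%:R * x ^+ 2).
Proof.
elim/poly_ind: p => [|p c [A A0 [m Am]]].
  by exists 0 => //; exists 0%N => x; rewrite horner0 normr0 mul0r.
exists (A + `|c|); first by rewrite addr_ge0.
exists m.+1 => x; rewrite hornerMXaddC.
have e1 : `|x| <= expR (x ^+ 2).
  apply: le_trans (expR_ge1Dx _).
  rewrite -real_normK ?num_real//; nra.
apply: le_trans (ler_normD _ _) _; rewrite mulrDl lerD//.
  rewrite normrM -natr1 mulrDl mul1r expRD mulrA.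
  by apply: ler_pM.
by rewrite ler_peMr// -expR0 ler_expR mulr_ge0// sqr_ge0.
Qed.

(** The bound is uniform over [s <= c], as differentiation under the integral
    sign requires; it comes from completing the square in [z = x^2]. *)
Lemma poly_freud_weight_le_gauss p c : exists2 K : R, 0 <= K &
  forall s x, s <= c -> `|p.[x] * freud_weight s x| <= K * gauss_fun x.
Proof.
have [A A0 [m Am]] := poly_le_expR_sqr p.
pose d := m%:R + 2 * c + 1 : R.
exists (A * expR (d ^+ 2)) => [|s x sc]; first by rewrite mulr_ge0// expR_ge0.
rewrite normrM (ger0_norm (expR_ge0 _)).
apply: (le_trans (ler_wpM2r (expR_ge0 _) (Am x))).
rewrite -!mulrA ler_wpM2l// -!expRD ler_expR.
have x0 : 0 <= x ^+ 2 by rewrite sqr_ge0.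
have : s * x ^+ 2 <= c * x ^+ 2 by rewrite ler_wpM2r.
have -> : x ^+ 4 = (x ^+ 2) ^+ 2 by rewrite -exprM.
move: (x ^+ 2) x0 => z z0 scz.
have := sqr_ge0 (d - z / 2); have := sqr_ge0 z; rewrite /d; nra.
Qed.

Lemma continuous_poly_freud_weight p s :
  continuous (fun x => p.[x] * freud_weight s x).
Proof.
move=> x; apply: cvgM; first exact: continuous_horner.
have -> : freud_weight s = expR \o horner (- 'X^4 + (2 * s) *: 'X^2).
  by apply/funext => z; rewrite /= /freud_weight !hornerE.
by apply: continuous_comp; [exact: continuous_horner|exact: continuous_expR].
Qed.

Lemma integrable_gauss_dominated (f : R -> R) K : continuous f ->
  (forall x, `|f x| <= K * gauss_fun x) ->
  mu.-integrable setT (EFin \o f).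
Proof.
move=> cf fK.
apply: (@le_integrable _ _ _ mu setT _ _ (fun x => (K%:E * (gauss_fun x)%:E)%E)) => //.
- by apply/measurable_EFinP; exact: continuous_measurable_fun.
- move=> x _; rewrite -EFinM /= lee_fin.
  exact: le_trans (fK x) (ler_norm _).
- by apply: integrableZl => //; exact: integrableT_gauss.
Qed.

Lemma integrable_poly_freud_weight p s :
  mu.-integrable setT (EFin \o (fun x => p.[x] * freud_weight s x)).
Proof.
have [K _ pK] := poly_freud_weight_le_gauss p s.
apply: (@integrable_gauss_dominated _ K); last by move=> x; exact: pK.
exact: continuous_poly_freud_weight.
Qed.

Definition freud_moment s p : R :=
  \int[mu]_x (p.[x] * freud_weight s x).

Lemma freud_formE s p q : freud_form s p q = freud_moment s (p * q).
Proof.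
by rewrite /freud_form /freud_moment; under eq_Rintegral do rewrite -hornerM.
Qed.

Lemma freud_moment_is_linear s : scalar (freud_moment s).
Proof.
move=> a p q; rewrite /freud_moment.
have aE : (fun x => a * (p.[x] * freud_weight s x)) =
    (fun x => (a *: p).[x] * freud_weight s x).
  by apply/funext => x; rewrite hornerZ mulrA.
rewrite -RintegralZl//; last exact: integrable_poly_freud_weight.
rewrite aE -RintegralD//; [|exact: integrable_poly_freud_weight..].
by apply: eq_Rintegral => x _; rewrite hornerD mulrDl.
Qed.

HB.instance Definition _ s := GRing.isLinear.Build R {poly R} R _
  (freud_moment s) (freud_moment_is_linear s).

Lemma finite_set_roots p : p != 0 -> finite_set [set x | root p x]%classic.
Proof.
move=> p0; apply: contrapT => inf.
have [B Br sB] := infinite_set_fset (size p) inf.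
have := @max_poly_roots _ p (finmap.enum_fset B) p0.
rewrite finmap.fset_uniq => /(_ _ isT); rewrite ltnNge sB => /(_ _)/negP; apply=> //.
by apply/allP => x xB; exact: Br.
Qed.

(** If the integral of the nonnegative function [p^2 w] were [0], then [p^2 w]
    would vanish almost everywhere, hence [p] would vanish off a null set; but
    the roots of [p] form a finite set, itself null. *)
Lemma freud_moment_sqr_gt0 s p : p != 0 -> 0 < freud_moment s (p * p).
Proof.
move=> p0; rewrite lt_neqAle andbC; apply/andP; split.
  apply: Rintegral_ge0 => x _.
  by rewrite hornerM mulr_ge0 ?expR_ge0// -expr2 sqr_ge0.
apply/negP => /eqP/esym I0.
pose f x := (p * p).[x] * freud_weight s x.
have f0 x : 0 <= f x.
  by rewrite /f hornerM mulr_ge0 ?expR_ge0// -expr2 sqr_ge0.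
have intf := integrable_poly_freud_weight (p * p) s.
have mf : measurable_fun setT (EFin \o f).
  apply/measurable_EFinP; apply: continuous_measurable_fun.
  exact: continuous_poly_freud_weight.
have If0 : (\int[mu]_(x in setT) `|(EFin \o f) x| = 0)%E.
  transitivity (\int[mu]_x (f x)%:E)%E.
    by apply: eq_integral => x _; rewrite gee0_abs// lee_fin.
  have : (\int[mu]_x (f x)%:E)%E \is a fin_num.
    exact: (integrable_fin_num measurableT intf).
  by move=> /fineK <-; congr EFin.
have [N [mN N0 subN]] := (ae_eq_integral_abs mu measurableT mf).1 If0.

have rts0 : mu [set x | root p x]%classic = 0%E.
  exact/countable_lebesgue_measure0/finite_set_countable/finite_set_roots.
have mrts : measurable [set x | root p x]%classic.
  exact/countable_measurable/finite_set_countable/finite_set_roots.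
have : mu setT = 0%E.
  apply: (@subset_measure0 _ _ _ mu _ (N `|` [set x | root p x])%classic) => //.
  - exact: measurableU.
  - move=> x _; have [rx|nrx] := boolP (root p x); [by right|left].
    apply: subN => /= /(_ Logic.I) [] /eqP.
    rewrite /f hornerM !mulf_eq0 orbb (gt_eqF (expR_gt0 _)) orbF.
    by move: nrx; rewrite rootE => /negP.
  - exact: (null_set_setU mN mrts N0 rts0).
by rewrite -set_itvNyy lebesgue_measure_itv.
Qed.

(** The weight is even and Lebesgue measure is its own image under negation. *)
Lemma freud_moment_comp_opp s p : freud_moment s (p \Po (- 'X)) = freud_moment s p.
Proof.
rewrite /freud_moment /Rintegral; congr fine.
pose f x := p.[x] * freud_weight s x.
have intf : mu.-integrable setT (EFin \o f) by exact: integrable_poly_freud_weight.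
have intfN : mu.-integrable ((-%R : R -> measurableTypeR R) @^-1` setT)
    ((EFin \o f) \o (-%R : R -> measurableTypeR R)).
  have := integrable_poly_freud_weight (p \Po (- 'X)) s.
  rewrite preimage_setT; apply: eq_integrable => // x _ /=; congr EFin.
  by rewrite /f freud_weightN horner_comp hornerN hornerX.
transitivity (\int[mu]_(x in (-%R : R -> measurableTypeR R) @^-1` setT)
   ((EFin \o f) \o (-%R : R -> measurableTypeR R)) x)%E.
  rewrite preimage_setT; apply: eq_integral => x _ /=; congr EFin.
  by rewrite /f freud_weightN horner_comp hornerN hornerX.
rewrite -integral_pushforward//; last first.
  exact: measurable_int intf.
apply: eq_measure_integral => A mA _.
exact: lebesgue_measureN.
Qed.
End FreudWeight.

(** * Integration by parts and differentiation in the parameter *)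
Section FreudMomentIdentities.
Local Open Scope classical_set_scope.
Local Open Scope ring_scope.
Variable R : realType.
Local Notation mu := (@lebesgue_measure R).
Implicit Types (p q : {poly R}) (s x : R).

Lemma is_derive_poly_freud_weight p s x :
  is_derive x 1 (fun z => p.[z] * freud_weight s z)
    ((p^`() - (4 *: 'X^3 - (4 * s) *: 'X) * p).[x] * freud_weight s x).
Proof.
pose u : {poly R} := - 'X^4 + (2 * s) *: 'X^2.
have wE : freud_weight s = expR \o horner u.
  by apply/funext => z; rewrite /= /freud_weight /u !hornerE.
rewrite wE.
apply: (@is_derive_eq _ _ _ _ _ _ _ _
  (is_deriveM (is_derive_poly p x)
    (is_derive1_comp (is_derive_expR _) (is_derive_poly u x)))).
rewrite /u /= derivD derivN derivZ !derivXn !hornerE /GRing.scale /=.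
set E := expR _. ring.
Qed.

(** Transfers the fundamental theorem of calculus from segments to the line,
    by dominated convergence. *)
Lemma integrable_cvg_segment (f : R -> R) : mu.-integrable setT (EFin \o f) ->
  (\int[mu]_(x in `[(- n.+1%:R)%R, n.+1%:R%R]) (f x)%:E)%E @[n --> \oo] -->
    (\int[mu]_x (f x)%:E)%E.
Proof.
move=> intf.
pose A (n : nat) : set R := `[- n.+1%:R, n.+1%:R]%classic.
have mA n : measurable (A n) by exact: measurable_itv.
have mf : measurable_fun setT (EFin \o f) by exact: measurable_int intf.
have [] := @dominated_convergence _ _ _ mu setT measurableT
  (fun n => (EFin \o f) \_ (A n)) (EFin \o f) (abse \o (EFin \o f)).
- move=> n; apply: (iffLR (measurable_restrictT (EFin \o f) (mA n))).
  exact: (measurable_funTS mf).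
- exact: mf.
- apply: aeW => x _; apply: cvg_near_cst.
  near=> n; rewrite patchE mem_set//= /A /= in_itv /= -ler_norml.
  apply: (@le_trans _ _ n%:R); last by rewrite ler_nat.
  by near: n; exact: nbhs_infty_ger.
- exact: integrable_abse.
- apply: aeW => x n _; rewrite patchE; case: ifP => // _.
  by rewrite abse0 abse_ge0.
move=> _ _; apply: cvg_trans; apply: near_eq_cvg; near=> n.
by rewrite /= [RHS]integral_mkcond.
Unshelve. all: end_near. Qed.

(** Pearson equation of the weight [w]: [p' w - (4 x^3 - 4 s x) p w] is the
    derivative of [p w], and [p w] tends to [0] at both infinities. *)
Lemma freud_moment_deriv s p :
  freud_moment s p^`() = freud_moment s ((4 *: 'X^3 - (4 * s) *: 'X) * p).
Proof.
pose d := p^`() - (4 *: 'X^3 - (4 * s) *: 'X) * p.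
pose g x := p.[x] * freud_weight s x.
suff d0 : freud_moment s d = 0.
  by apply/eqP; rewrite -subr_eq0 -linearB /= -/d d0.
have [K K0 gK] := poly_freud_weight_le_gauss p s.
have intd := integrable_poly_freud_weight d s.
have := integrable_cvg_segment intd.
have FTC n : (\int[mu]_(x in `[(- n.+1%:R)%R, n.+1%:R%R]%classic)
    (d.[x] * freud_weight s x)%:E = (g n.+1%:R - g (- n.+1%:R))%:E)%E.
  rewrite (@continuous_FTC2 _ _ g) ?EFinB//.
  - by rewrite gtrN.
  - exact/continuous_subspaceT/continuous_poly_freud_weight.
  - split.
    + by move=> x _; have [] := is_derive_poly_freud_weight p s x.
    + exact/cvg_at_right_filter/continuous_poly_freud_weight.
    + exact/cvg_at_left_filter/continuous_poly_freud_weight.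
  - by move=> x _; rewrite derive1E; have [_ ->] := is_derive_poly_freud_weight p s x.
under eq_fun do rewrite FTC.
have -> : (\int[mu]_x (d.[x] * freud_weight s x)%:E)%E = (freud_moment s d)%:E.
  rewrite /freud_moment /Rintegral fineK//.
  exact: (integrable_fin_num measurableT intd).
move=> /fine_cvg /= cv.
have g0 : g n.+1%:R - g (- n.+1%:R) @[n --> \oo] --> (0 : R).
  have gauss0 : gauss_fun (n.+1%:R : R) @[n --> \oo] --> (0 : R).
    apply: (cvg_comp (fun n => n.+1%:R : R) _ _ (@cvg_gauss_fun R)).
    by rewrite (cvg_shiftS (fun n => n%:R : R)); exact: cvgr_idn.
  apply: (@squeeze_cvgr _ _ _ _ (fun n => - (2 * K * gauss_fun n.+1%:R))
    (fun n => 2 * K * gauss_fun n.+1%:R)).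
  - apply: nearW => n; rewrite -ler_norml.
    have := gK s n.+1%:R (lexx s); have := gK s (- n.+1%:R) (lexx s).
    rewrite -/(g n.+1%:R) -/(g (- n.+1%:R)) /gauss_fun sqrrN => h1 h2.
    have := ler_normB (g n.+1%:R) (g (- n.+1%:R)); lra.
  - rewrite -oppr0 -(mulr0 (2 * K)); apply: cvgN.
    by apply: cvgM; [exact: cvg_cst|exact: gauss0].
  - by rewrite -(mulr0 (2 * K)); apply: cvgM; [exact: cvg_cst|exact: gauss0].
by rewrite -(cvg_lim _ cv)//; apply: cvg_lim.
Qed.

(** Differentiation under the integral sign on the interval
    [(s - 1, s + 1)]: the derivative of the weight in its parameter is
    [2 x^2] times the weight. *)
Lemma is_derive_freud_moment s p :
  is_derive s 1 (fun s => freud_moment s p) (2 * freud_moment s ('X^2 * p)).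
Proof.
have der x (z : R) : is_derive z 1 (fun z' => p.[x] * freud_weight z' x)
   (2 * (('X^2 * p).[x] * freud_weight z x)).
  pose u : {poly R} := (2 * x ^+ 2) *: 'X + (- x ^+ 4)%:P.
  have -> : (fun z' => p.[x] * freud_weight z' x) =
      (fun z' => p.[x] * (expR \o horner u) z').
    by apply/funext => z'; rewrite /= /freud_weight /u hornerD hornerZ hornerX hornerC;
    congr (_ * expR _); ring.
  have -> : freud_weight z x = expR u.[z].
    by rewrite /freud_weight /u hornerD hornerZ hornerX hornerC; congr expR; ring.
  apply: (@is_derive_eq _ _ _ _ _ _ _ _
    (is_deriveZ p.[x] (is_derive1_comp (is_derive_expR _) (is_derive_poly u z)))).
  rewrite {2}/u derivD derivZ derivX derivC !hornerE /GRing.scale /=.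
  set E := expR _. ring.
have [K K0 gK] := poly_freud_weight_le_gauss ('X^2 * p) (s + 1).
have Is : `]s - 1, s + 1[%classic s.
  by rewrite /= in_itv /=; lra.
have d1E z x : partial1of2 (fun z x => p.[x] * freud_weight z x) z x =
   2 * (('X^2 * p).[x] * freud_weight z x).
  by rewrite partial1of2E; have [_ ->] := der x z.
have cvd : h^-1 *: (freud_moment (h + s) p - freud_moment s p) @[h --> 0^'] -->
    \int[mu]_x (2 * (('X^2 * p).[x] * freud_weight s x)).
  under eq_Rintegral do rewrite -d1E.
  apply: (@cvg_differentiation_under_integral R _ _ mu
   (fun z x => p.[x] * freud_weight z x) setT measurableT s (s - 1) (s + 1)
   Is _ _ (fun x => 2 * (K * gauss_fun x))).
  - by move=> z _; exact: integrable_poly_freud_weight.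
  - by move=> z x _ _; have [] := der x z.
  - by move=> x; rewrite !mulr_ge0// gauss_fun_ge0.
  - apply: (@integrable_gauss_dominated _ _ (2 * K)) => [x|x].
      do 2! [apply: cvgM; first exact: cvg_cst].
      exact: continuous_gauss_fun.
    by rewrite mulrA ger0_norm// mulr_ge0 ?gauss_fun_ge0// mulr_ge0.
  - move=> z x /=; rewrite in_itv/= => /andP[_ zs] _.
    by rewrite d1E normrM ger0_norm// ler_wpM2l// gK// ltW.
have cvd' : h^-1 *: (freud_moment (h *: 1 + s) p - freud_moment s p) @[h --> 0^'] -->
     2 * freud_moment s ('X^2 * p).
  rewrite -(RintegralZl _ measurableT (integrable_poly_freud_weight ('X^2 * p) s)).
  under eq_fun do rewrite [_ *: 1]mulr1.
  exact: cvd.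
apply: DeriveDef; first by apply/cvg_ex; exists (2 * freud_moment s ('X^2 * p)).
exact: (cvg_lim _ cvd').
Qed.
End FreudMomentIdentities.

(** * Orthogonal polynomials of a positive functional *)
Section OrthogonalPolynomials.
Variables (R : realType) (L : {scalar {poly R}}) (P : int -> {poly R}).
Hypothesis Lpos : forall p : {poly R}, p != 0 -> 0 < L (p * p).
Hypothesis hP : monic_orthogonal_sequence (fun p q => L (p * q)) P.
Implicit Types (p q E : {poly R}) (n m : nat).

Lemma coef_lead_ops n : (P n)`_n = 1.
Proof.
have [_ /(_ n) mon /(_ n) sz _] := hP.
by move/monicP: mon; rewrite lead_coefE sz.
Qed.

Lemma ops_neq0 n : P n != 0.
Proof. by have [_ mon _ _] := hP; exact: monic_neq0. Qed.

Lemma size_ops n : size (P n) = n.+1. Proof. by have [] := hP. Qed.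

Lemma ops_neg k : k < 0 -> P k = 0. Proof. by have [+ _ _ _] := hP; exact. Qed.

Lemma coef_ops_gt n i : (n < i)%N -> (P n)`_i = 0.
Proof. by move=> ni; rewrite nth_default// size_ops. Qed.

Lemma ops0 : P 0%N = 1.
Proof.
have /eqP/size_poly1P[c c0 Pc] := size_ops 0.
by have := coef_lead_ops 0; rewrite Pc coefC => /= ->.
Qed.

Lemma ops_norm_gt0 n : 0 < L (P n * P n).
Proof. by apply: Lpos; exact: ops_neq0. Qed.

Lemma size_sub_lead n q : (size q <= n.+1)%N -> (size (q - q`_n *: P n)%R <= n)%N.
Proof.
move=> sq; apply/leq_sizeP => i; rewrite leq_eqVlt => /predU1P[<-|ni].
  by rewrite coefB coefZ coef_lead_ops mulr1 subrr.
rewrite coefB coefZ (nth_default _ (leq_trans sq ni)).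
rewrite [(P n)`_i]nth_default ?size_ops//.
by rewrite mulr0 subrr.
Qed.

Lemma orthogonal_span E n : (forall m, (m < n)%N -> L (E * P m) = 0) ->
  forall q, (size q <= n)%N -> L (E * q) = 0.
Proof.
elim: n => [_ q|n ih En q sq].
  by rewrite leqn0 size_poly_eq0 => /eqP->; rewrite mulr0 linear0.
have -> : E * q = E * (q - q`_n *: P n) + q`_n *: (E * P n).
  by rewrite mulrBr -scalerAr subrK.
rewrite linearD scalarZ /= (ih _ _ (size_sub_lead sq)) ?En ?mulr0 ?addr0// => m mn.
by apply: En; rewrite ltnS ltnW.
Qed.

(** All the polynomial identities below are proved by this uniqueness
    principle: positivity is applied to [E] itself, so a candidate expansion
    need only be tested against [P_0], ..., [P_(n-1)]. *)
Lemma orthogonal_eq0 E n : (size E <= n)%N ->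
  (forall m, (m < n)%N -> L (E * P m) = 0) -> E = 0.
Proof.
move=> sE EP; apply/eqP; apply: contraT => /Lpos.
by rewrite (orthogonal_span EP)// ltxx.
Qed.

Lemma ops_orthogonal_lower n q : (size q <= n)%N -> L (P n * q) = 0.
Proof.
apply: orthogonal_span => m mn; have [_ _ _ ort] := hP.
by apply: ort => nm; move: mn; rewrite nm ltnn.
Qed.

Lemma ops_orthogonal m n : (m == n) = false -> L (P m * P n) = 0.
Proof. by have [_ _ _ ort] := hP => /eqP; exact: ort. Qed.

(** Subtracting the right multiple of [P_n] lowers the degree of [q]. *)
Lemma ops_inner_lead n q : (size q <= n.+1)%N ->
  L (P n * q) = q`_n * L (P n * P n).
Proof.
move=> sq.
have -> : P n * q = P n * (q - q`_n *: P n) + q`_n *: (P n * P n).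
  by rewrite mulrBr -scalerAr subrK.
by rewrite linearD scalarZ /= (ops_orthogonal_lower (size_sub_lead sq)) add0r.
Qed.

Lemma ops_expansion n q : (size q <= n)%N ->
  q = \sum_(j < n) (L (q * P j) / L (P j * P j)) *: P j.
Proof.
move=> sq; apply/eqP; rewrite -subr_eq0; apply/eqP.
apply: (@orthogonal_eq0 _ n) => [|m mn].
  rewrite (leq_trans (size_polyD _ _))// geq_max sq size_polyN.
  rewrite (leq_trans (size_sum _ _ _))//; apply/bigmax_leqP => i _.
  by rewrite (leq_trans (size_scale_leq _ _))// size_ops.
rewrite mulrBl linearB /= mulr_suml linear_sum /= (bigD1 (Ordinal mn))//=.
rewrite big1 => [|j jm].
  by rewrite addr0 -scalerAl scalarZ /= divfK ?subrr// gt_eqF ?ops_norm_gt0.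
rewrite -scalerAl scalarZ /=; have [_ _ _ ort] := hP.
rewrite (ort j m) ?mulr0// => jmE; case/eqP: jm; exact: val_inj.
Qed.

(** With [r = (x - y) q] one has [P_n q = r^2], so [L (P_n q)] is both
    positive and, since [deg q < n], zero. *)
Lemma ops_simple_root n y q : P n = ('X - y%:P) ^+ 2 * q -> False.
Proof.
move=> Pq; have q0 : q != 0.
  by apply/eqP => q0; have := ops_neq0 n; rewrite Pq q0 mulr0 eqxx.
have sq : (size q <= n)%N.
  have := size_ops n; rewrite Pq size_mul ?expf_neq0 ?polyXsubC_eq0//.
  by rewrite size_exp_XsubC /= => -[<-]; rewrite add1n.
have := ops_orthogonal_lower sq.
have -> : P n * q = (('X - y%:P) * q) * (('X - y%:P) * q) by rewrite Pq; ring.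
by apply/eqP; rewrite gt_eqF// Lpos// mulf_neq0// polyXsubC_eq0.
Qed.

Lemma ops_zeros_inj n (z : 'I_n -> R) :
  P n = \prod_(k < n) ('X - (z k)%:P) -> injective z.
Proof.
move=> Pz i j zij; apply/eqP; apply: contraT => ij.
case: (@ops_simple_root n (z i)
  (\prod_(k < n | (k != i) && (k != j)) ('X - (z k)%:P))).
by rewrite Pz (bigD1 i)//= (bigD1 j) 1?eq_sym//= -zij mulrA.
Qed.

Hypothesis Leven : forall p : {poly R}, L (p \Po - 'X) = L p.

Lemma coef_comp_opp p i : (p \Po - 'X)`_i = (-1) ^+ i * p`_i.
Proof.
elim/poly_ind: p i => [|p c ih] i; first by rewrite comp_poly0 !coef0 mulr0.
rewrite comp_polyD comp_polyM comp_polyX comp_polyC mulrN !coefD coefN.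
rewrite !coefMX !coefC; case: i => [|i] /=; first by rewrite oppr0 !add0r mul1r.
by rewrite ih !addr0 exprS mulN1r mulNr.
Qed.

Lemma even_functional_odd p : p \Po - 'X = - p -> L p = 0.
Proof.
by move=> po; have := Leven p; rewrite po linearN /=; lra.
Qed.

(** [P_n (-x)] is orthogonal to all lower degrees because [L] is even, and
    its leading coefficient is [(-1)^n]. *)
Lemma ops_parity n : P n \Po - 'X = (-1) ^+ n *: P n.
Proof.
apply/eqP; rewrite -subr_eq0; apply/eqP; apply: (@orthogonal_eq0 _ n).
  apply/leq_sizeP => i; rewrite leq_eqVlt coefB coefZ coef_comp_opp.
  case/predU1P => [<-|ni]; first by rewrite subrr.
  by rewrite (@nth_default _ _ _ i) ?size_ops// !mulr0 subrr.
move=> m mn; rewrite mulrBl linearB /= -scalerAl scalarZ /=.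
rewrite (@ops_orthogonal_lower n (P m)) ?size_ops// mulr0 subr0.
rewrite -Leven comp_polyM -comp_polyA [(- 'X) \Po _]raddfN /= comp_polyX opprK.
rewrite comp_polyXr.
apply: ops_orthogonal_lower; apply/leq_sizeP => i ni.
by rewrite coef_comp_opp nth_default ?mulr0// size_ops (leq_trans mn).
Qed.

Lemma ops_parity_inner e r m n : r \Po - 'X = (-1) ^+ e *: r ->
  odd (e + m + n) -> L (r * P m * P n) = 0.
Proof.
move=> ro emn; apply: even_functional_odd; rewrite !comp_polyM !ops_parity ro.
rewrite -!scalerAl -!scalerAr -!scalerAl !scalerA -!exprD -signr_odd.
rewrite (_ : odd _ = true); first by rewrite expr1 scaleN1r.
by rewrite -emn !oddD; case: (odd e); case: (odd m); case: (odd n).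
Qed.

Lemma ops_innerX_self n : L ('X * P n * P n) = 0.
Proof.
apply: (@ops_parity_inner 1) => [|]; first by rewrite comp_polyX scaleN1r.
by rewrite add1n addSn /= addnn odd_double.
Qed.

Lemma ops_recurrence0 : 'X * P 0%N = P 1%N.
Proof.
apply/eqP; rewrite -subr_eq0; apply/eqP; apply: (@orthogonal_eq0 _ 1).
  rewrite ops0 mulr1; apply/leq_sizeP => i; rewrite leq_eqVlt coefB coefX.
  case/predU1P => [<-|ni]; first by rewrite coef_lead_ops subrr.
  by rewrite gtn_eqF// nth_default ?size_ops// subrr.
case=> // _; rewrite mulrBl linearB /= ops_innerX_self.
by rewrite ops_orthogonal_lower ?subrr// size_ops.
Qed.

Lemma ops_recurrence n : 'X * P n.+1 =
  P n.+2 + (L (P n.+1 * P n.+1) / L (P n * P n)) *: P n.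
Proof.
apply/eqP; rewrite -subr_eq0; apply/eqP; apply: (@orthogonal_eq0 _ n.+2).
  apply/leq_sizeP => i ni; rewrite coefB coefD coefXM coefZ.
  rewrite [(P n)`_i]nth_default ?size_ops ?(ltn_trans _ ni)// mulr0 addr0.
  case: i ni => //= i; rewrite ltnS leq_eqVlt => /predU1P[<-|ni].
    by rewrite !coef_lead_ops subrr.
  by rewrite !nth_default ?size_ops ?subrr.
move=> m; rewrite mulrBl mulrDl linearB linearD /= -scalerAl scalarZ /=.
rewrite ltnS leq_eqVlt => /predU1P[->|mn].
  rewrite ops_innerX_self (ops_orthogonal (gtn_eqF (ltnSn n.+1))).
  by rewrite (ops_orthogonal (ltn_eqF (ltnSn n))) mulr0 addr0 subr0.
have sm : (size (P m) <= n.+1)%N by rewrite size_ops.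
rewrite (@ops_inner_lead n _ sm) (@ops_orthogonal_lower n.+2 (P m)); last first.
  exact: leqW.
rewrite mulrAC mulrC (@ops_inner_lead n.+1 ('X * P m)); last first.
  by rewrite mulrC size_mulX ?ops_neq0// size_ops.
by rewrite coefXM add0r mulrCA divfK ?subrr// gt_eqF ?ops_norm_gt0.
Qed.

(** [ops_prev n] stands for the predecessor of [P_n], and [ops_ratio n] for
    the recurrence coefficient [a_n^2]; both are [0] at [n = 0], so that
    [ops_recurrenceE] covers all indices. *)
Definition ops_prev n : {poly R} := if n is k.+1 then P k else 0.

Definition ops_ratio n : R :=
  if n is k.+1 then L (P k.+1 * P k.+1) / L (P k * P k) else 0.

Lemma ops_recurrenceE n : 'X * P n = P n.+1 + ops_ratio n *: ops_prev n.
Proof.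
by case: n => [|n]; [rewrite scale0r addr0 ops_recurrence0|exact: ops_recurrence].
Qed.

Lemma ops_ratioS n : ops_ratio n.+1 * L (P n * P n) = L (P n.+1 * P n.+1).
Proof. by rewrite divfK// gt_eqF ?ops_norm_gt0. Qed.

Lemma ops_innerX_succ n : L ('X * P n * P n.+1) = L (P n.+1 * P n.+1).
Proof.
rewrite ops_recurrenceE mulrDl linearD /= -scalerAl scalarZ.
case: n => [|n] /=; first by rewrite !mul0r addr0.
by rewrite (ops_orthogonal (ltn_eqF (leqnSn n.+1))) mulr0 addr0.
Qed.

Lemma ops_normX n : L ('X * P n * ('X * P n)) =
  L (P n.+1 * P n.+1) + ops_ratio n * L (P n * P n).
Proof.
rewrite {1}ops_recurrenceE mulrDl linearD /= -scalerAl scalarZ; congr (_ + _).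
  by rewrite mulrC ops_innerX_succ.
case: n => [|n]; first by rewrite !mul0r.
by rewrite /ops_prev mulrA [P n * 'X]mulrC ops_innerX_succ.
Qed.

End OrthogonalPolynomials.

Arguments ops_ratio {R} L P n : simpl never.


(** * Polynomials paired through multiplication by x^2 *)
Section LoweringByTwo.
Implicit Types (n m : nat).
Variables (R : realType) (L : {scalar {poly R}}) (P : int -> {poly R}).
Hypothesis Lpos : forall p : {poly R}, p != 0 -> 0 < L (p * p).
Hypothesis Leven : forall p : {poly R}, L (p \Po - 'X) = L p.
Hypothesis hP : monic_orthogonal_sequence (fun p q => L (p * q)) P.

Lemma ops_innerX2_odd n m : odd (n + m) -> L (P n * ('X^2 * P m)) = 0.
Proof.
move=> nm; rewrite (_ : P n * _ = 'X^2 * P n * P m); last by ring.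
apply: (ops_parity_inner Lpos hP Leven (e := 2)).
  by rewrite comp_Xn_poly !sqrrN expr1n scale1r.
by rewrite -addnA oddD nm.
Qed.

(** [x^2 P_m] has degree less than [n + 2] when [m < n], and [P_(n+2) P_(n+1)]
    is odd; only the component along [P_n] survives. *)
Lemma ops_two_below n c (D : {poly R}) : (size D <= n.+2)%N ->
  (forall q : {poly R}, (size q <= n.+2)%N -> L (D * q) = c * L (P n.+2 * ('X^2 * q))) ->
  D = (c * L (P n.+2 * P n.+2) / L (P n * P n)) *: P n.
Proof.
move=> sD DE; apply/eqP; rewrite -subr_eq0; apply/eqP.
apply: (orthogonal_eq0 Lpos hP (n := n.+2)).
  apply/leq_sizeP => i ni; rewrite coefB coefZ (coef_ops_gt hP) ?mulr0 ?subr0.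
    by rewrite nth_default// (leq_trans sD).
  exact: ltn_trans ni.
move=> m; rewrite ltnS mulrBl linearB /= -scalerAl (scalarZ L) => mn.
rewrite DE ?(size_ops hP)//; move: mn; rewrite leq_eqVlt => /predU1P[->|mn].
  rewrite ops_innerX2_odd; last by rewrite addSn addSn addnS /= addnn odd_double.
  by rewrite (ops_orthogonal hP (ltn_eqF (ltnSn n))) !mulr0 subrr.
have sm : (size (P m) <= n.+1)%N by rewrite (size_ops hP).
rewrite (ops_inner_lead hP sm) (ops_inner_lead hP (n := n.+2)); last first.
  apply/leq_sizeP => -[|[|i]]// ni.
  by rewrite coefXnM /= !subSS subn0 (coef_ops_gt hP) ?(leq_trans mn).
rewrite coefXnM /= !subSS subn0; field.
by rewrite gt_eqF ?(ops_norm_gt0 Lpos hP).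
Qed.

Lemma ops_two_below_deg1 c (D : {poly R}) : (size D <= 1)%N ->
  (forall q : {poly R}, (size q <= 1)%N -> L (D * q) = c * L (P 1 * ('X^2 * q))) ->
  D = 0.
Proof.
move=> sD DE; apply: (orthogonal_eq0 Lpos hP sD) => -[|//] _.
by rewrite DE ?(size_ops hP)// ops_innerX2_odd// mulr0.
Qed.

End LoweringByTwo.

(** * Structure relations from the Pearson equation *)
Section PearsonFunctional.
Implicit Types (n m : nat).
Variables (R : realType) (L : {scalar {poly R}}) (F : int -> {poly R}) (t : R).
Hypothesis Lpos : forall p : {poly R}, p != 0 -> 0 < L (p * p).
Hypothesis hF : monic_orthogonal_sequence (fun p q => L (p * q)) F.
Hypothesis Leven : forall p : {poly R}, L (p \Po - 'X) = L p.
Hypothesis Lderiv : forall p : {poly R},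
  L p^`() = L ((4 *: 'X^3 - (4 * t) *: 'X) * p).
Local Notation a := (ops_ratio L F).
Local Notation h n := (L (F n * F n)).
Local Notation V' := (4 *: 'X^3 - (4 * t) *: 'X : {poly R}).

Lemma freud_potential_odd : V' \Po - 'X = - V'.
Proof.
rewrite comp_polyB !comp_polyZ comp_polyX comp_Xn_poly.
rewrite exprNn -signr_odd /= expr1 mulN1r !scalerN; ring.
Qed.

(** Integration by parts; the term [L (F_(n+1) F_m')] drops by degree. *)
Lemma deriv_ops_inner n m : (m <= n)%N ->
  L ((F n.+1)^`() * F m) = L (V' * F n.+1 * F m).
Proof.
move=> mn; have := Lderiv (F n.+1 * F m); rewrite derivM linearD /= mulrA => <-.
rewrite (@ops_orthogonal_lower _ L F hF n.+1 (F m)^`()) ?addr0//.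
apply/leq_sizeP => i ni; rewrite coef_deriv (coef_ops_gt hF) ?mul0rn//.
by rewrite ltnS (leq_trans mn)// ltnW.
Qed.

(** One factor [x] of [x^3] is given to [F_(n+1)] and two to [F_n], and the
    recurrence is applied to each. *)
Lemma potential_deriv_inner_succ n : L (V' * F n.+1 * F n) =
  4 * h n.+1 * (a n.+2 + a n.+1 + a n - t).
Proof.
have -> : V' * F n.+1 * F n = 4 *: ('X * F n.+1 * ('X * ('X * F n)))
    - (4 * t) *: ('X * F n * F n.+1).
  by rewrite mulrBl mulrBl -!scalerAl; congr (_ *: _ - _ *: _); ring.
have E : L ('X * F n.+1 * ('X * ('X * F n))) =
    h n.+2 + a n.+1 * (h n.+1 + a n * h n).
  rewrite (ops_recurrenceE Lpos hF Leven n.+1).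
  rewrite mulrDl linearD /= -scalerAl (scalarZ L); congr (_ + _ * _).
    rewrite (@ops_inner_lead _ L F hF n.+2); last first.
      apply/leq_sizeP => -[|[|i]]// ni.
      by rewrite !coefXM /= (coef_ops_gt hF) ?(leq_trans _ ni).
    by rewrite !coefXM /= (coef_lead_ops hF) mul1r.
  have -> : F n * ('X * ('X * F n)) = 'X * F n * ('X * F n) by ring.
  by rewrite (ops_normX Lpos hF Leven).
rewrite linearB /= !(scalarZ L) E (ops_innerX_succ Lpos hF Leven).
rewrite -(ops_ratioS Lpos hF n.+1) -(ops_ratioS Lpos hF n). ring.
Qed.

(** By [deriv_ops_inner], the components of [F_(n+1)'] along [F_m] vanish for
    [m < n - 2] by degree and for [m = n - 1] by parity. What remains is
    [F_n] and [F_(n-2)], the latter written here through [x F_(n-1)]. *)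
Lemma deriv_opsE n : (F n.+1)^`() = (4 * a n.+1) *:
  ((a n.+2 + a n.+1 - t) *: F n + a n *: ('X * ops_prev F n)).
Proof.
apply/eqP; rewrite -subr_eq0; apply/eqP; apply: (orthogonal_eq0 Lpos hF (n := n.+1)).
  apply/leq_sizeP => i ni; rewrite coefB coef_deriv (coef_ops_gt hF)// mul0rn.
  rewrite coefZ coefD !coefZ coefXM (coef_ops_gt hF ni).
  case: i ni => // i; rewrite ltnS => ni /=.
  case: n ni => [|n] ni /=; first by rewrite coef0 !mulr0 addr0 mulr0 subrr.
  by rewrite (coef_ops_gt hF ni) !mulr0 addr0 mulr0 subrr.
move=> m; rewrite ltnS => mn; rewrite mulrBl linearB /= deriv_ops_inner//.
rewrite -scalerAl (scalarZ L).
rewrite (_ : (_ *: F n + _) * F m = (a n.+2 + a n.+1 - t) *: (F n * F m)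
  + a n *: ('X * ops_prev F n * F m)); last by rewrite mulrDl -!scalerAl.
rewrite linearD /= !(scalarZ L).
move: mn; rewrite leq_eqVlt => /predU1P[->|mn].
  rewrite potential_deriv_inner_succ; case: n => [|n] /=.
    rewrite -(ops_ratioS Lpos hF) (_ : a 0 = 0)//; ring.
  rewrite ops_innerX_succ// -(ops_ratioS Lpos hF n.+1); ring.
case: n mn => // n; rewrite ltnS leq_eqVlt => /predU1P[->|mn].
  rewrite (ops_parity_inner Lpos hF Leven (e := 1)) ?freud_potential_odd ?scaleN1r//;
    last by rewrite !addnS /= addnn odd_double.
  rewrite ops_innerX_self// (ops_orthogonal hF (gtn_eqF (ltnSn n))).
  by rewrite !mulr0 addr0 mulr0 subr0.
have sXF : (size ('X * F m)%R <= n.+1)%N.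
  by rewrite mulrC size_mulX ?(ops_neq0 hF)// (size_ops hF).
rewrite (ops_orthogonal hF (gtn_eqF (leqW mn))) mulr0 add0r /=.
have -> : 'X * F n * F m = F n * ('X * F m) by ring.
have -> : V' * F n.+2 * F m = F n.+2 * (V' * F m) by ring.
have VE i : (V' * F m)`_i.+3 = 4 * (F m)`_i - 4 * t * (F m)`_i.+2.
  rewrite (_ : V' * F m = 4 *: ('X^3 * F m) - (4 * t) *: ('X * F m)).
    by rewrite coefB !coefZ coefXnM coefXM /= !subSS subn0.
  by rewrite mulrBl -!scalerAl.
rewrite (ops_inner_lead hF sXF) (ops_inner_lead hF (n := n.+2)); last first.
  apply/leq_sizeP => -[|[|[|i]]]// ni.
  by rewrite VE !(coef_ops_gt hF) ?mulr0 ?subrr//; lia.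
case: n mn sXF => // n mn _.
rewrite VE coefXM /= (coef_ops_gt hF (i := n.+2)); last by lia.
rewrite -(ops_ratioS Lpos hF n.+2) -(ops_ratioS Lpos hF n.+1); ring.
Qed.

Lemma ops_recurrence_horner n y :
  a n * (ops_prev F n).[y] = y * (F n).[y] - (F n.+1).[y].
Proof.
have /(congr1 (horner^~ y)) := ops_recurrenceE Lpos hF Leven n.
rewrite hornerM hornerX hornerD hornerZ => ->; ring.
Qed.

(** [deriv_opsE] with [F_(n-1)] eliminated by the recurrence, so that only
    [F_n] and [F_(n+1)] are left. *)
Lemma deriv_ops_raise n y : (F n.+1)^`().[y] =
  4 * a n.+1 * ((a n.+2 + a n.+1 - t + y ^+ 2) * (F n).[y] - y * (F n.+1).[y]).
Proof.
rewrite deriv_opsE !hornerZ hornerD !hornerZ hornerM hornerX.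
have := ops_recurrence_horner n y; set u := (ops_prev F n).[y] => auE.
rewrite (_ : a n * (y * u) = y * (a n * u)); last by ring.
rewrite auE; ring.
Qed.

(** The previous relation one index lower, again rewritten in terms of [F_n]
    and [F_(n+1)]. *)
Lemma deriv_ops_lower n y : (F n)^`().[y] =
  4 * (y * (a n.+1 - t + y ^+ 2) * (F n).[y] -
       (a n.+1 + a n - t + y ^+ 2) * (F n.+1).[y]).
Proof.
case: n => [|n].
  have := ops_recurrence_horner 0 y; rewrite (ops0 hF) derivC !hornerC.
  rewrite (_ : a 0 = 0)// mul0r => /esym/eqP; rewrite subr_eq0 => /eqP <-; ring.
have /= := ops_recurrence_horner n.+1 y; rewrite deriv_ops_raise => auE.
rewrite (_ : 4 * a n.+1 * _ =
    4 * ((a n.+2 + a n.+1 - t + y ^+ 2) * (a n.+1 * (F n).[y]) -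
         a n.+1 * y * (F n.+1).[y])); last by ring.
rewrite auE; ring.
Qed.

End PearsonFunctional.

(** * Adding a mass at the origin *)
Definition add_mass (R : realType) (L : {poly R} -> R) (M : R) (p : {poly R}) : R :=
  L p + M * p.[0].

Section MassPoint.
Implicit Types (n m : nat).
Variables (R : realType) (L : {scalar {poly R}}) (M : R).

Lemma add_mass_is_linear : scalar (add_mass L M).
Proof.
move=> c p q; rewrite /add_mass linearP hornerD hornerZ; ring.
Qed.

HB.instance Definition _ := GRing.isLinear.Build R {poly R} R _
  (add_mass L M) add_mass_is_linear.

Variables (F Q : int -> {poly R}).
Hypothesis M_ge0 : 0 <= M.
Hypothesis Lpos : forall p : {poly R}, p != 0 -> 0 < L (p * p).
Hypothesis Leven : forall p : {poly R}, L (p \Po - 'X) = L p.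

Lemma add_mass_pos (p : {poly R}) : p != 0 -> 0 < add_mass L M (p * p).
Proof.
by move=> p0; rewrite ltr_pwDl ?Lpos// hornerM -expr2 mulr_ge0// sqr_ge0.
Qed.

Lemma add_mass_even (p : {poly R}) : add_mass L M (p \Po - 'X) = add_mass L M p.
Proof. by rewrite /add_mass Leven horner_comp hornerN hornerX oppr0. Qed.

Hypothesis hF : monic_orthogonal_sequence (fun p q => L (p * q)) F.
Hypothesis hQ : monic_orthogonal_sequence (fun p q => add_mass L M (p * q)) Q.
Local Notation h n := (L (F n * F n)).
Local Notation hQ_ n := (add_mass L M (Q n * Q n)).

(** This is [1 + M K_(n-1) (0, 0)]; the shift by one makes the case of the
    empty kernel the natural number [0]. *)
Definition mass_kernel n : R :=
  1 + M * \sum_(j < n) (F j).[0] ^+ 2 / h j.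

Lemma mass_kernel_gt0 n : 0 < mass_kernel n.
Proof.
rewrite ltr_pwDl// mulr_ge0// sumr_ge0// => j _.
by rewrite divr_ge0 ?sqr_ge0// ltW// (ops_norm_gt0 Lpos hF).
Qed.

(** For [j < n] the component of [Q_n - F_n] along [F_j] is
    [- M Q_n (0) F_j (0) / |F_j|^2]; evaluating the expansion at [0] gives a
    linear equation for [Q_n (0)]. *)
Lemma mass_ops_at0 n : (Q n).[0] * mass_kernel n = (F n).[0].
Proof.
have /(size_sub_lead hF) : (size (Q n) <= n.+1)%N by rewrite (size_ops hQ).
rewrite (coef_lead_ops hQ) scale1r => /(ops_expansion Lpos hF) E.
have : (Q n - F n).[0] = - M * (Q n).[0] * \sum_(j < n) (F j).[0] ^+ 2 / h j.
  rewrite {}E horner_sum mulr_sumr; apply: eq_bigr => j _.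
  rewrite hornerZ mulrBl linearB /= (ops_orthogonal hF (gtn_eqF (ltn_ord j))).
  have : add_mass L M (Q n * F j) = 0.
    by apply: (ops_orthogonal_lower hQ); rewrite (size_ops hF).
  rewrite /add_mass hornerM => /eqP; rewrite addr_eq0 => /eqP ->; ring.
rewrite hornerD hornerN /mass_kernel; set S := \sum_(_ < _) _ => QE.
rewrite mulrDr mulr1; move/eqP: QE; rewrite subr_eq => /eqP QE.
lra.
Qed.

(** [LM (Q_n Q_n) = LM (Q_n F_n) = |F_n|^2 + M Q_n (0) F_n (0)], and the value
    [Q_n (0)] is known from [mass_ops_at0]. *)
Lemma mass_ops_norm n : hQ_ n * mass_kernel n = h n * mass_kernel n.+1.
Proof.
have sF : (size (F n) <= n.+1)%N by rewrite (size_ops hF).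
have sQ : (size (Q n) <= n.+1)%N by rewrite (size_ops hQ).
have := ops_inner_lead hQ sF; rewrite (coef_lead_ops hF) mul1r => <-.
rewrite /= /add_mass [Q n * F n]mulrC (ops_inner_lead hF sQ).
rewrite (coef_lead_ops hQ) mul1r hornerM mulrDl.
rewrite (_ : M * ((F n).[0] * (Q n).[0]) * mass_kernel n = M * (F n).[0] ^+ 2).
  rewrite /mass_kernel big_ord_recr /= mulrDr !mulrDr addrA; congr (_ + _ + _).
  by field; rewrite gt_eqF ?(ops_norm_gt0 Lpos hF).
by rewrite -(mass_ops_at0 n); ring.
Qed.

(** Multiplication by [x] makes the mass invisible:
    [L (x Q_(n+1) F_m) = LM (Q_(n+1) x F_m)]. Hence [x (Q_(n+1) - F_(n+1))] is
    orthogonal to every [F_m] with [m < n], and by parity to [F_(n+1)]. *)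
Lemma mass_ops_relation n :
  'X * Q n.+1 = 'X * F n.+1 + ((hQ_ n.+1 - h n.+1) / h n) *: F n.
Proof.
apply/eqP; rewrite -subr_eq0; apply/eqP; apply: (orthogonal_eq0 Lpos hF (n := n.+2)).
  apply/leq_sizeP => -[//|i] ni; rewrite coefB coefD !coefXM coefZ /=.
  rewrite (coef_ops_gt hF (i := i.+1)) ?mulr0 ?addr0; last by lia.
  move: ni; rewrite ltnS leq_eqVlt => /predU1P[<-|ni].
    by rewrite (coef_lead_ops hF) (coef_lead_ops hQ) subrr.
  by rewrite (coef_ops_gt hF) ?(coef_ops_gt hQ)// subrr.
move=> m; rewrite mulrBl mulrDl linearB linearD /= -scalerAl (scalarZ L).
rewrite ltnS leq_eqVlt => /predU1P[->|mn].
  rewrite (ops_innerX_self Lpos hF Leven) (ops_orthogonal hF (ltn_eqF (leqnn n.+1))).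
  rewrite mulr0 addr0 subr0; apply: (even_functional_odd Leven).
  rewrite !comp_polyM (ops_parity Lpos hF Leven).
  rewrite (ops_parity add_mass_pos hQ add_mass_even).
  by rewrite comp_polyX -!scalerAr -!scalerAl scalerA -expr2 sqrr_sign scale1r !mulNr.
have sm : (size (F m) <= n.+1)%N by rewrite (size_ops hF).
have sXm : (size ('X * F m)%R <= n.+2)%N.
  by rewrite mulrC size_mulX ?(ops_neq0 hF)// (size_ops hF).
have -> : L ('X * Q n.+1 * F m) = add_mass L M (Q n.+1 * ('X * F m)).
  rewrite /add_mass !hornerM hornerX mul0r mulr0 mulr0 addr0; congr (L _); ring.
have -> : 'X * F n.+1 * F m = F n.+1 * ('X * F m) by ring.
rewrite (ops_inner_lead hQ sXm) (ops_inner_lead hF sXm) (ops_inner_lead hF sm).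
rewrite coefXM /=; field; rewrite gt_eqF ?(ops_norm_gt0 Lpos hF)//.
Qed.

Variable t : R.
Hypothesis Lderiv : forall p : {poly R},
  L p^`() = L ((4 *: 'X^3 - (4 * t) *: 'X) * p).
Local Notation a := (ops_ratio L F).

(** The derivative of [mass_ops_relation] in [x]; the term [Q_(n+1) (y)] that
    the product rule creates on the left is zero. *)
Lemma mass_ops_deriv_at_zero n b y :
  hQ_ n.+1 = b * h n.+1 -> (Q n.+1).[y] = 0 ->
  y * (Q n.+1)^`().[y] =
    (1 - 4 * a n.+1 * (b * y ^+ 2 + (b - 1) * (a n.+1 + a n - t))) * (F n.+1).[y]
    + 4 * a n.+1 * y * (b * (y ^+ 2 - t + a n.+1) + a n.+2) * (F n).[y].
Proof.
move=> bE Qy; have /(congr1 (fun p => p^`().[y])) := mass_ops_relation n.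
have -> : (hQ_ n.+1 - h n.+1) / h n = (b - 1) * a n.+1.
  by rewrite bE -[X in _ - X]mul1r -mulrBl -mulrA.
rewrite derivD derivZ !derivM derivX !mul1r.
rewrite !hornerD hornerZ !hornerM !hornerX Qy add0r => ->.
rewrite (deriv_ops_raise Lpos hF Leven Lderiv) (deriv_ops_lower Lpos hF Leven Lderiv).
ring.
Qed.

End MassPoint.

(** * Differentiating a family of orthogonal polynomials in a parameter *)
Section DerivedFamily.
Local Open Scope classical_set_scope.
Local Open Scope ring_scope.
Variable R : realType.
Implicit Types (q D : {poly R}) (p : R -> {poly R}) (t : R) (n k i : nat).

(** Coefficientwise differentiability, with a degree bound near [t] so that
    values and functionals of [p s] are finite sums of fixed length. *)
Definition has_coef_derive t p D := exists N,
  [/\ (size D <= N)%N, \forall s \near t, (size (p s) <= N)%N &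
      forall i, is_derive t 1 (fun s => (p s)`_i) D`_i].

Lemma is_derive_horner_family t p D x : has_coef_derive t p D ->
  is_derive t 1 (fun s => (p s).[x]) D.[x].
Proof.
move=> [N [sD sp dp]].
have E : \forall s \near t, (\sum_(i < N) (fun s => x ^+ i *: (p s)`_i)) s = (p s).[x].
  near=> s; rewrite (@horner_coef_wide _ N); last by near: s.
  by rewrite fct_sumE; apply: eq_bigr => i _; rewrite mulrC.
apply: (near_eq_is_derive E).
rewrite (horner_coef_wide x sD); under [X in is_derive _ _ _ X]eq_bigr do rewrite mulrC.
apply: is_derive_sum => i; exact: is_deriveZ.
Unshelve. all: end_near. Qed.

Lemma is_derive_functional_family t p D q (L : R -> {scalar {poly R}})
    (L' : {scalar {poly R}}) :
  (forall r, is_derive t 1 (fun s => L s r) (L' r)) -> has_coef_derive t p D ->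
  is_derive t 1 (fun s => L s (p s * q)) (L t (D * q) + L' (p t * q)).
Proof.
move=> dL [N [sD sp dp]].
have expand (K : {scalar {poly R}}) (r : {poly R}) : (size r <= N)%N ->
    K (r * q) = \sum_(i < N) r`_i * K ('X^i * q).
  move=> sr; rewrite [in LHS](_ : r = \sum_(i < N) r`_i *: 'X^i).
    by rewrite mulr_suml linear_sum; apply: eq_bigr => i _; rewrite -scalerAl scalarZ.
  rewrite -(@poly_def _ N); apply/polyP => i; rewrite coef_poly.
  by case: ltnP => // Ni; rewrite nth_default// (leq_trans sr).
have E : \forall s \near t,
    (\sum_(i < N) (fun s => (p s)`_i * L s ('X^i * q))) s = L s (p s * q).
  near=> s; rewrite (expand (L s)); last by near: s.
  by rewrite fct_sumE.
apply: (near_eq_is_derive E).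
rewrite (expand (L t))// (expand L'); last exact: nbhs_singleton sp.
rewrite -big_split /=; apply: is_derive_sum => i.
apply: (is_derive_eq (is_deriveM (dp i) (dL ('X^i * q)))).
by rewrite /GRing.scale /= addrC [D`_i * _]mulrC.
Unshelve. all: end_near. Qed.

Lemma near_coef_derive t p1 p2 D : (\forall s \near t, p1 s = p2 s) ->
  has_coef_derive t p1 D -> has_coef_derive t p2 D.
Proof.
move=> p12 [N [sD sp dp]]; exists N; split => // [|i].
  by apply: filterS2 p12 sp => s <-.
apply: near_eq_is_derive (dp i); by apply: filterS p12 => s ->.
Qed.

Lemma coef_derive_cst t q : has_coef_derive t (fun=> q) 0.
Proof.
exists (size q); split; [by rewrite size_poly0|exact: (@nearW R (nbhs t))|].
by move=> i; rewrite coef0; exact: is_derive_cst.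
Qed.

Lemma coef_deriveD t p1 p2 D1 D2 :
  has_coef_derive t p1 D1 -> has_coef_derive t p2 D2 ->
  has_coef_derive t (fun s => p1 s + p2 s) (D1 + D2).
Proof.
move=> [N1 [sD1 sp1 dp1]] [N2 [sD2 sp2 dp2]]; exists (maxn N1 N2); split.
- by rewrite (leq_trans (size_polyD _ _))// geq_max !leq_max sD1 sD2 orbT.
- apply: filterS2 sp1 sp2 => s s1 s2.
  by rewrite (leq_trans (size_polyD _ _))// geq_max !leq_max s1 s2 orbT.
- move=> i; rewrite coefD; under eq_fun do rewrite coefD.
  exact: is_deriveD.
Qed.

Lemma coef_deriveZ t (c : R -> R) p c' D :
  is_derive t 1 c c' -> has_coef_derive t p D ->
  has_coef_derive t (fun s => c s *: p s) (c t *: D + c' *: p t).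
Proof.
move=> dc [N [sD sp dp]]; exists N; split.
- rewrite (leq_trans (size_polyD _ _))// geq_max !(leq_trans (size_scale_leq _ _))//.
  exact: nbhs_singleton sp.
- by apply: filterS sp => s; apply: leq_trans; exact: size_scale_leq.
- move=> i; rewrite coefD !coefZ; under eq_fun do rewrite coefZ.
  apply: (is_derive_eq (is_deriveM dc (dp i))).
  by rewrite /GRing.scale /= [c' * _]mulrC.
Qed.

Lemma coef_derive_sum t n (f : 'I_n -> R -> {poly R}) :
  (forall k : 'I_n, exists D, has_coef_derive t (f k) D) ->
  exists D, has_coef_derive t (fun s => \sum_(k < n) f k s) D.
Proof.
move=> df; elim: (index_enum _) => [|k r [D ih]].
  exists 0; under eq_fun do rewrite big_nil; exact: coef_derive_cst.
have [Dk dk] := df k.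
exists (Dk + D); under eq_fun do rewrite big_cons; exact: coef_deriveD.
Qed.

Variables (t : R) (L : R -> {scalar {poly R}}) (L' : {scalar {poly R}}).
Hypothesis dL : forall r : {poly R}, is_derive t 1 (fun s => L s r) (L' r).
Variable P : R -> int -> {poly R}.
Hypothesis Lpos : \forall s \near t, forall q, q != 0 -> 0 < L s (q * q).
Hypothesis hP : \forall s \near t,
  monic_orthogonal_sequence (fun q r => L s (q * r)) (P s).

Lemma ops_inner_Xn (K : {scalar {poly R}}) (O : int -> {poly R}) n :
  monic_orthogonal_sequence (fun q r => K (q * r)) O ->
  K (O n * 'X^n) = K (O n * O n).
Proof.
by move=> hO; rewrite (ops_inner_lead hO) ?size_polyXn// coefXn eqxx mul1r.
Qed.

Lemma ops_gram_schmidt (K : {scalar {poly R}}) (O : int -> {poly R}) n :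
  (forall q, q != 0 -> 0 < K (q * q)) ->
  monic_orthogonal_sequence (fun q r => K (q * r)) O ->
  O n = 'X^n - \sum_(k < n) (K (O k * 'X^n) / K (O k * 'X^k)) *: O k.
Proof.
move=> Kpos hO.
have sX : (size ('X^n - O n)%R <= n)%N.
  have := size_sub_lead hO (n := n) (q := 'X^n).
  by rewrite coefXn eqxx scale1r; apply; rewrite size_polyXn.
rewrite -[LHS](subKr 'X^n); congr (_ - _); rewrite {1}(ops_expansion Kpos hO sX).
apply: eq_bigr => k _; rewrite (ops_inner_Xn k hO); congr ((_ / _) *: _).
by rewrite mulrBl linearB /= (ops_orthogonal hO (gtn_eqF (ltn_ord k))) subr0 mulrC.
Qed.

(** Gram-Schmidt makes [P_n] a rational expression, with nonzero
    denominators, in the moments and the coefficients of the lower [P_k]. *)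
Lemma ops_coef_derive n : exists D, has_coef_derive t (fun s => P s n) D.
Proof.
elim/ltn_ind: n => n ih.
have [D dS] : exists D, has_coef_derive t (fun s => \sum_(k < n)
    (L s (P s k * 'X^n) / L s (P s k * 'X^k)) *: P s k) D.
  apply: coef_derive_sum => k; have [D dk] := ih k (ltn_ord k).
  have dn := is_derive_functional_family 'X^n dL dk.
  have dd := is_derive_functional_family 'X^k dL dk.
  eexists; apply: coef_deriveZ dk.
  apply: is_deriveM dn _.
  apply: is_deriveV dd.
  have hPt := nbhs_singleton hP.
  by rewrite (ops_inner_Xn k hPt) gt_eqF// (ops_norm_gt0 (nbhs_singleton Lpos) hPt).
eexists; apply: (@near_coef_derive _ (fun s => 'X^n + -1 *: \sum_(k < n)
    (L s (P s k * 'X^n) / L s (P s k * 'X^k)) *: P s k)).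
  by apply: filterS2 Lpos hP => s Ls hs; rewrite [RHS](ops_gram_schmidt n Ls hs) scaleN1r.
apply: coef_deriveD; first exact: coef_derive_cst.
by apply: coef_deriveZ dS; exact: is_derive_cst.
Qed.

(** The derivative at [t] of the identity [L s (P_n q) = 0]. *)
Lemma ops_variation n D q : has_coef_derive t (fun s => P s n) D ->
  (size q <= n)%N -> L t (D * q) = - L' (P t n * q).
Proof.
move=> dP sq; have [_ dE] := is_derive_functional_family q dL dP.
apply/eqP; rewrite -addr_eq0 -dE.
have E : \forall s \near t, cst 0 s = L s (P s n * q).
  by apply: filterS hP => s hs; rewrite (ops_orthogonal_lower hs).
by rewrite -(near_eq_derive _ E) ?oner_eq0// derive_cst.
Qed.

(** The leading coefficient stays equal to [1], so its derivative is [0]. *)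
Lemma size_ops_derive n D : has_coef_derive t (fun s => P s n) D -> (size D <= n)%N.
Proof.
move=> [N [_ _ dP]]; apply/leq_sizeP => i ni.
have [_ <-] := dP i.
have E : \forall s \near t, cst (n == i)%:R s = (P s n)`_i.
  apply: filterS hP => s hs; move: ni; rewrite leq_eqVlt => /predU1P[<-|ni].
    by rewrite eqxx (coef_lead_ops hs).
  by rewrite (coef_ops_gt hs)// (ltn_eqF ni).
by rewrite -(near_eq_derive _ E) derive_cst.
Qed.

End DerivedFamily.

(** * Motion of simple ordered zeros *)
Section OrderedZeros.
Local Open Scope classical_set_scope.
Local Open Scope ring_scope.
Variables (R : realType) (n : nat).

Lemma increasing_ord_id (f : 'I_n -> 'I_n) :
  (forall i j : 'I_n, (i < j)%N -> (f i < f j)%N) -> forall i, f i = i.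
Proof.
move=> fi.
have ge : forall (k : nat) (i : 'I_n), i = k :> nat -> (k <= f i)%N.
  elim=> // k ih i ik.
  have kn : (k < n)%N by rewrite (ltn_trans _ (ltn_ord i))// ik.
  apply: leq_ltn_trans (ih (Ordinal kn) erefl) (fi _ _ _).
  by rewrite ik /=.
have le : forall (k : nat) (i : 'I_n), (i + k).+1 = n -> (f i <= i)%N.
  elim=> [|k ih] i ik; first by rewrite -ltnS -[X in (_ < X.+1)%N]addn0 ik ltn_ord.
  have kn : (i.+1 < n)%N by lia.
  have h1 : (f i < f (Ordinal kn))%N by apply: fi => /=.
  have := ih (Ordinal kn); rewrite /= => /(_ _)h2.
  rewrite -ltnS (leq_trans h1)// h2//; lia.
move=> i; apply/val_inj/eqP; rewrite eqn_leq (ge i i erefl) (le (n - i).-1)//.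
by have := ltn_ord i; lia.
Qed.

Variables (P : R -> {poly R}) (y : 'I_n -> R -> R) (t : R).
Hypothesis Pz : \forall s \near t, ordered_zeros (P s) (fun k => y k s).
Hypothesis Pcont : forall x, (P s).[x] @[s --> t] --> (P t).[x].
Hypothesis yinj : injective (fun k => y k t).

Let y_lt (i j : 'I_n) : (i < j)%N -> y i t < y j t.
Proof.
move=> ij; have [_ le] := nbhs_singleton Pz.
rewrite lt_neqAle le ?(ltnW ij)// andbT.
by apply/eqP => /yinj yij; move: ij; rewrite yij ltnn.
Qed.

Let zeros_separated : exists2 g : R, 0 < g &
  forall i j : 'I_n, (i < j)%N -> 2 * g <= y j t - y i t.
Proof.
exists (\big[Num.min/1]_(p : 'I_n * 'I_n | (p.1 < p.2)%N) ((y p.2 t - y p.1 t) / 2)).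
  by apply: lt_bigmin => // -[i j] /= ij; rewrite divr_gt0// subr_gt0 y_lt.
move=> i j ij; rewrite mulrC -ler_pdivlMr//.
exact: (@bigmin_le_cond _ _ _ _ (i, j)).
Qed.

(** [|P s (y_i t)|] is the product of the [n] distances from [y_i t] to the
    zeros of [P s]. Once it is less than [d ^ n], one of these distances is
    less than [d]. When [d] is at most half of every gap between zeros at time
    [t], the index of that near zero is strictly increasing in [i], hence is
    [i] itself. *)
Lemma ordered_zeros_continuous k : y k s @[s --> t] --> y k t.
Proof.
have [g g0 yg] := zeros_separated.
apply/cvgrPdist_lt => e e0.
pose d := Num.min e g.
have d0 : 0 < d by rewrite lt_min e0.
have Pyt i : (P t).[y i t] = 0.
  have [-> _] := nbhs_singleton Pz.
  by rewrite horner_prod (bigD1 i)//= hornerXsubC subrr mul0r.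
have small : \forall s \near t, forall i, `|(P s).[y i t]| < d ^+ n.
  apply: (@filter_forall R 'I_n (fun i s => `|(P s).[y i t]| < d ^+ n) (nbhs t)) => i.
  have /cvgr0Pnorm_lt : (P s).[y i t] @[s --> t] --> 0.
    by rewrite -(Pyt i); exact: Pcont.
  by apply; rewrite exprn_gt0.
near=> s.
have [Ps le] : ordered_zeros (P s) (fun k => y k s) by near: s.
have sm : forall i, `|(P s).[y i t]| < d ^+ n by near: s.
have /choice[f fd] : forall i, exists j, `|y i t - y j s| < d.
  move=> i; apply: contrapT => /forallNP far.
  have := sm i; rewrite Ps horner_prod normr_prod.
  rewrite -[X in d ^+ X]card_ord -prodr_const ltNge => /negP; apply.
  apply: ler_prod => j _; rewrite ltW//= hornerXsubC leNgt.
  exact/negP/far.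
have fk : f k = k.
  apply: increasing_ord_id => i j ij; rewrite ltnNge; apply/negP => /le.
  have := fd i; have := fd j; have := yg _ _ ij.
  have : d <= g by rewrite ge_min lexx orbT.
  rewrite !ltr_norml => dg h /andP[h1 h2] /andP[h3 h4]; lra.
by have := fd k; rewrite fk => /lt_le_trans; apply; rewrite ge_min lexx.
Unshelve. all: end_near. Qed.

(** Since [P s (y_k t) = (y_k t - y_k s) r s] with [r] continuous at [t] and
    [r t] the slope of [P t] at its zero [y_k t], the difference quotient of
    [y_k] is that of [P s (y_k t)] divided by [- r s]. *)
Lemma is_derive_ordered_zeros k d :
  is_derive t 1 (fun s => (P s).[y k t]) d ->
  is_derive t 1 (y k) (- d / (P t)^`().[y k t]).
Proof.
move=> [der <-].
pose r s := \prod_(j < n | j != k) (y k t - y j s).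
have Pr s : ordered_zeros (P s) (fun k => y k s) ->
    (P s).[y k t] = (y k t - y k s) * r s.
  move=> [-> _]; rewrite horner_prod (bigD1 k)//= hornerXsubC; congr (_ * _).
  by apply: eq_bigr => j _; rewrite hornerXsubC.
have rt : (P t)^`().[y k t] = r t.
  have [-> _] := nbhs_singleton Pz; rewrite (bigD1 k)//= derivM derivXsubC mul1r.
  rewrite hornerD hornerM hornerXsubC subrr mul0r addr0 horner_prod.
  by apply: eq_bigr => j _; rewrite hornerXsubC.
have rt0 : r t != 0.
  by apply/prodf_neq0 => j jk; rewrite subr_eq0; apply: contra jk => /eqP/yinj ->.
have rc : r s @[s --> t] --> r t.
  apply: cvg_big => [|j _]; first exact: mul_continuous.
  by apply: cvgB; [exact: cvg_cst|exact: ordered_zeros_continuous].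
have shift : (h *: 1 + t : R) @[h --> (0 : R)^'] --> t.
  have shift0 : (h *: 1 + t : R) @[h --> (0 : R)] --> (0 *: 1 + t : R).
    by apply: cvgD; [apply: cvgZr_tmp; exact: cvg_id|exact: cvg_cst].
  by rewrite scale0r add0r in shift0; exact: cvg_within_filter.
have rsh : r (h *: 1 + t) @[h --> (0 : R)^'] --> r t by exact: cvg_comp shift rc.
have near_r0 : \forall h \near (0 : R)^', r (h *: 1 + t) != 0 by exact: cvgr_neq0 rsh rt0.
have near_zeros : \forall h \near (0 : R)^',
    ordered_zeros (P (h *: 1 + t)) (fun k => y k (h *: 1 + t)) by exact: shift Pz.
pose q h := - (h^-1 *: ((P (h *: 1 + t)).[y k t] - (P t).[y k t])) / r (h *: 1 + t).
have cv : h^-1 *: (y k (h *: 1 + t) - y k t) @[h --> (0 : R)^'] -->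
    - 'D_1 (fun s => (P s).[y k t]) t / r t.
  apply: (@cvg_trans _ (q @ 0^')); last first.
    apply: cvgM; first exact: cvgN der.
    exact: cvgV rsh.
  apply: near_eq_cvg; near=> h.
  have r0 : r (h *: 1 + t) != 0 by near: h.
  rewrite /q Pr; last by near: h.
  rewrite (Pr t (nbhs_singleton Pz)) subrr mul0r subr0 /GRing.scale /=.
  by rewrite mulrA -mulNr mulfK//; ring.
rewrite rt; apply: DeriveDef; last exact: cvg_lim cv.
by apply/cvg_ex; exists (- 'D_1 (fun s => (P s).[y k t]) t / r t).
Unshelve. all: end_near. Qed.
End OrderedZeros.

(** * The Freud and Freud-type functionals *)
Section FreudFamily.
Variable R : realType.
Implicit Types (s t M : R) (p q : {poly R}).

Definition freud_moment_dt t p : R := 2 * freud_moment t ('X^2 * p).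

Lemma freud_moment_dt_is_linear t : scalar (freud_moment_dt t).
Proof.
by move=> c p q; rewrite /freud_moment_dt mulrDr -scalerAr linearP /=; ring.
Qed.

HB.instance Definition _ t := GRing.isLinear.Build R {poly R} R _
  (freud_moment_dt t) (freud_moment_dt_is_linear t).

Lemma freud_type_formE M s p q :
  freud_type_form M s p q = add_mass (freud_moment s) M (p * q).
Proof. by rewrite /freud_type_form freud_formE /add_mass hornerM mulrA. Qed.

Lemma is_derive_add_mass M t p :
  is_derive t 1 (fun s => add_mass (freud_moment s) M p) (freud_moment_dt t p).
Proof.
rewrite -[freud_moment_dt t p]addr0.
exact: is_deriveD (is_derive_freud_moment t p) (is_derive_cst _ _ _).
Qed.

Variables (M t : R) (F : int -> {poly R}).

Lemma a2_ops_ratio (n : nat) : a2 t F n = ops_ratio (freud_moment t) F n.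
Proof.
case: n => [|n]; rewrite /a2 //= /norm2 !freud_formE /ops_ratio.
by rewrite (_ : n.+1%:Z - 1 = n)//; lia.
Qed.

Lemma kernel_poly_mass_kernel (n : nat) :
  1 + M * kernel_poly t F (n%:Z - 1) 0 0 = mass_kernel (freud_moment t) M F n.
Proof.
case: n => [|n]; first by rewrite /mass_kernel big_ord0.
rewrite (_ : n.+1%:Z - 1 = n); last by lia.
rewrite /mass_kernel /=; congr (1 + M * _); apply: eq_bigr => j _.
by rewrite /norm2 freud_formE.
Qed.

Lemma b_mass_kernel (n : nat) : b M t F n =
  mass_kernel (freud_moment t) M F n.+1 / mass_kernel (freud_moment t) M F n.
Proof.
rewrite /b kernel_poly_mass_kernel -(kernel_poly_mass_kernel n.+1).
by rewrite (_ : n.+1%:Z - 1 = n)//; lia.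
Qed.

End FreudFamily.

(** * Freud-type polynomials and their zeros *)
Section Consequences.
Variables (R : realType) (M t : R) (F Q : R -> int -> {poly R}).
Hypothesis M_ge0 : 0 <= M.
Hypothesis t_gt0 : 0 < t.
Hypothesis hF : forall s : R, 0 < s -> monic_orthogonal_sequence (freud_form s) (F s).
Hypothesis hQ : forall s : R, 0 < s ->
  monic_orthogonal_sequence (freud_type_form M s) (Q s).
Implicit Types (n m : nat).

Local Notation L := (freud_moment t).
Local Notation LM := (add_mass (freud_moment t) M).
Local Notation h n := (L (F t n * F t n)).
Local Notation hQ_ n := (LM (Q t n * Q t n)).
Local Notation kap n := (mass_kernel (freud_moment t) M (F t) n).

Let hFL : monic_orthogonal_sequence (fun p q => L (p * q)) (F t).
Proof.
by have [? ? ? ort] := hF t_gt0; split=> // m n /ort; rewrite freud_formE.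
Qed.

Let hQL s : 0 < s ->
  monic_orthogonal_sequence (fun p q => add_mass (freud_moment s) M (p * q)) (Q s).
Proof.
by move=> /hQ[? ? ? ort]; split=> // m n /ort; rewrite freud_type_formE.
Qed.

Let Lpos := @freud_moment_sqr_gt0 R t.
Let Leven := @freud_moment_comp_opp R t.
Let LMpos := add_mass_pos M_ge0 Lpos.
Let LMeven := add_mass_even M Leven.

Lemma near_gt0 : \forall s \near t, 0 < s.
Proof. exact: cvgr_gt cvg_id _ t_gt0. Qed.

(** [x^2] vanishes at the origin, so the derivative of the functional, which
    is the moment of [2 x^2 p] without the mass, can be written with the mass
    included. *)
Lemma freud_type_coef_derive n : exists2 D : {poly R},
  has_coef_derive t (fun s => Q s n) D & (size D <= n)%N /\
  forall q : {poly R}, (size q <= n)%N ->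
    LM (D * q) = - 2 * LM (Q t n * ('X^2 * q)).
Proof.
have pos : \forall s \near t, forall q, q != 0 -> 0 < add_mass (freud_moment s) M (q * q).
  apply: (@nearW R (nbhs t)) => s; apply: add_mass_pos => // p.
  exact: freud_moment_sqr_gt0.
have ort : \forall s \near t,
    monic_orthogonal_sequence (fun p q => add_mass (freud_moment s) M (p * q)) (Q s).
  by apply: filterS near_gt0 => s; exact: hQL.
have [D dD] := ops_coef_derive (is_derive_add_mass M t) pos ort n.
exists D => //; split; first exact: (size_ops_derive ort dD).
move=> q sq; rewrite (ops_variation (is_derive_add_mass M t) ort dD sq).
rewrite /= /freud_moment_dt /add_mass !hornerM !hornerX !(mul0r, mulr0) addr0.
by rewrite mulNr mulrCA.
Qed.

Lemma freud_type_derive n : has_coef_derive t (fun s => Q s n.+2)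
  ((- 2 * hQ_ n.+2 / hQ_ n) *: Q t n).
Proof.
have [D dD [sD DE]] := freud_type_coef_derive n.+2.
by rewrite -(ops_two_below LMpos LMeven (hQL t_gt0) sD DE).
Qed.

Lemma freud_type_derive1 : has_coef_derive t (fun s => Q s 1) 0.
Proof.
have [D dD [sD DE]] := freud_type_coef_derive 1.
by rewrite -(ops_two_below_deg1 LMpos LMeven (hQL t_gt0) sD DE).
Qed.

Lemma freud_type_norm n : hQ_ n = h n * (kap n.+1 / kap n).
Proof.
rewrite mulrA -(mass_ops_norm Lpos hFL (hQL t_gt0)) mulfK//.
by rewrite gt_eqF// (mass_kernel_gt0 M_ge0 Lpos hFL).
Qed.

Lemma freud_type_flatE n : - 2 * hQ_ n.+2 / hQ_ n =
  - (2 / (kap n.+1 / kap n)) *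
  (ops_ratio L (F t) n.+2 * ops_ratio L (F t) n.+1 +
   M * (F t n.+2).[0] ^+ 2 / (kap n.+2 * h n)).
Proof.
have k0 m : kap m != 0 by rewrite gt_eqF// (mass_kernel_gt0 M_ge0 Lpos hFL).
have h0 m : h m != 0 by rewrite gt_eqF// (ops_norm_gt0 Lpos hFL).
have kS : kap n.+3 = kap n.+2 + M * ((F t n.+2).[0] ^+ 2 / h n.+2).
  by rewrite /mass_kernel big_ord_recr /= mulrDr addrA.
rewrite !freud_type_norm kS /ops_ratio; field.
by rewrite !k0 !h0.
Qed.

(** Hence [b_n / (b_(n+1) a_(n+1)^2)] is the inverse of the recurrence
    coefficient of the Freud-type family. *)
Lemma freud_type_ratio n : ops_ratio LM (Q t) n.+1 =
  (kap n.+2 / kap n.+1) * ops_ratio L (F t) n.+1 / (kap n.+1 / kap n).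
Proof.
have k0 m : kap m != 0 by rewrite gt_eqF// (mass_kernel_gt0 M_ge0 Lpos hFL).
have h0 m : h m != 0 by rewrite gt_eqF// (ops_norm_gt0 Lpos hFL).
rewrite /ops_ratio /= !freud_type_norm; field.
by rewrite !k0 !h0.
Qed.

Lemma freud_type_zero_derive n (y : 'I_n -> R -> R) (D : {poly R}) k :
  (forall s : R, 0 < s -> ordered_zeros (Q s n) (fun k : 'I_n => y k s)) ->
  has_coef_derive t (fun s => Q s n) D ->
  is_derive t 1 (y k) (- D.[y k t] / (Q t n)^`().[y k t]).
Proof.
move=> hy dD.
apply: (@is_derive_ordered_zeros _ _ (fun s => Q s n)).
- by apply: filterS near_gt0 => s; exact: hy.
- move=> x; have [dx _] := is_derive_horner_family x dD.
  have : {for t, continuous (fun s => (Q s n).[x])}.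
    by apply: differentiable_continuous; apply/derivable1_diffP.
  exact.
- by have [Qz _] := hy t t_gt0; exact: (ops_zeros_inj LMpos (hQL t_gt0) Qz).
- exact: is_derive_horner_family dD.
Qed.

End Consequences.

Theorem theorem12 (R : realType) (M : R) (F Q : R -> int -> {poly R})
    (n : nat) (y : 'I_n -> R -> R) (t : R)
    (hM : 0 <= M)
    (hF : forall s : R, 0 < s ->
       monic_orthogonal_sequence (freud_form s) (F s))
    (hQ : forall s : R, 0 < s ->
       monic_orthogonal_sequence (freud_type_form M s) (Q s))
    (hn : (0 < n)%N) (ht : 0 < t)
    (hy : forall s : R, 0 < s ->
       ordered_zeros (Q s n) (fun k : 'I_n => y k s)) :
  let a2_ (k : int) : R := a2 t (F t) k in
  let b_ (k : int) : R := b M t (F t) k in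
  exists flat : R,
    [/\ forall x : R,
          is_derive t 1 (fun s : R => (Q s n).[x])
            (flat * (Q t (n%:Z - 2)).[x]),
        flat = - (2 / b_ (n%:Z - 2)) *
          (a2_ n * a2_ (n%:Z - 1) +
           M * (F t n).[0] ^+ 2 /
             ((1 + M * kernel_poly t (F t) (n%:Z - 1) 0 0) *
              norm2 t (F t (n%:Z - 2))))
      & forall k : 'I_n,
          let yk := y k t in
          let C1 := 1 - 4 * a2_ n *
            (b_ n * yk ^+ 2 + (b_ n - 1) * (a2_ n + a2_ (n%:Z - 1) - t)) in
          let C2 := 4 * a2_ n * yk *
            (b_ n * (yk ^+ 2 - t + a2_ n) + a2_ (n%:Z + 1)) in
          is_derive t 1 (y k)
            ((- yk ^+ 2 * flat *
                (b_ (n%:Z - 2) / (b_ (n%:Z - 1) * a2_ (n%:Z - 1))) *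
                (Q t (n%:Z - 1)).[yk]) /
             (C1 * (F t n).[yk] + C2 * (F t (n%:Z - 1)).[yk]))].
Proof.
have Lpos := @freud_moment_sqr_gt0 R t.
have Leven := @freud_moment_comp_opp R t.
have Lderiv := freud_moment_deriv t.
have hFL : monic_orthogonal_sequence (fun p q => freud_moment t (p * q)) (F t).
  by have [? ? ? ort] := hF t ht; split=> // m k /ort; rewrite freud_formE.
have hQL : monic_orthogonal_sequence
    (fun p q => add_mass (freud_moment t) M (p * q)) (Q t).
  by have [? ? ? ort] := hQ t ht; split=> // m k /ort; rewrite freud_type_formE.
have LMpos := add_mass_pos hM Lpos.
have LMeven := add_mass_even M Leven.
move=> a2_ b_.
have Qy k : (Q t n).[y k t] = 0.
  by have [-> _] := hy t ht; rewrite horner_prod (bigD1 k)//= hornerXsubC subrr mul0r.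
case: n hn y hy Qy => [//|[|n]] _ {}y {}hy Qy.
  (* degree 1: the zero is 0 at all times, and [Q_(-1) = 0] *)
  have dQ := freud_type_derive1 hM ht hQ.
  eexists; split; [|reflexivity|].
    move=> x; rewrite (_ : 1%:Z - 2 = -1)// (ops_neg hQL)// horner0 mulr0.
    by rewrite -(horner0 x); exact: is_derive_horner_family dQ.
  move=> k yk C1 C2.
  have yk0 : yk = 0.
    move: (Qy k); rewrite -(ops_recurrence0 LMpos hQL LMeven) (ops0 hQL) mulr1.
    by rewrite hornerX.
  have := freud_type_zero_derive hM ht hQ k hy dQ.
  by rewrite horner0 oppr0 mul0r yk0 expr0n /= oppr0 !mul0r.
have dQ := freud_type_derive hM ht hQ n.
have n2 : n.+2%:Z - 2 = n by lia.
have n1 : n.+2%:Z - 1 = n.+1 by lia.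
have n3 : n.+2%:Z + 1 = n.+3 by lia.
(* from here on the degree is [n + 2] *)
exists (- 2 * add_mass (freud_moment t) M (Q t n.+2 * Q t n.+2) /
   add_mass (freud_moment t) M (Q t n * Q t n)); split.
- by move=> x; rewrite n2 -hornerZ; exact: is_derive_horner_family dQ.
- rewrite (freud_type_flatE hM ht hF hQ) /b_ /a2_ kernel_poly_mass_kernel n2 n1.
  rewrite !a2_ops_ratio !b_mass_kernel.
  by rewrite /norm2 freud_formE.
move=> k yk C1 C2.
set flat := - 2 * _ / add_mass _ _ _.
have := freud_type_zero_derive hM ht hQ k hy dQ.
rewrite hornerZ -/yk.
have CE : yk * (Q t n.+2)^`().[yk] = C1 * (F t n.+2).[yk] + C2 * (F t (n.+2%:Z - 1)).[yk].
  rewrite n1 (mass_ops_deriv_at_zero hM Lpos Leven hFL hQL Lderiv (b := b_ n.+2)) ?Qy//.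
    by rewrite /C1 /C2 /a2_ n1 n3 !a2_ops_ratio.
  by rewrite /b_ b_mass_kernel (freud_type_norm hM ht hF hQ) mulrC.
rewrite -CE.
have rec := ops_recurrence_horner LMpos hQL LMeven n.+1 yk.
move: rec; rewrite Qy subr0 /= => rec.
have r0 : ops_ratio (add_mass (freud_moment t) M) (Q t) n.+1 != 0.
  by rewrite mulf_neq0 ?invr_eq0 ?gt_eqF ?(ops_norm_gt0 LMpos hQL).
have ratioE : b_ (n.+2%:Z - 2) / (b_ (n.+2%:Z - 1) * a2_ (n.+2%:Z - 1)) =
    (ops_ratio (add_mass (freud_moment t) M) (Q t) n.+1)^-1.
  rewrite n1 n2 /b_ /a2_ !b_mass_kernel a2_ops_ratio (freud_type_ratio hM ht hF hQ).
  by rewrite invf_div.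
rewrite ratioE n1.
move: r0 rec {ratioE}; move: (ops_ratio _ _ _) => r r0 rec.
have -> : (Q t n).[yk] = yk * (Q t n.+1).[yk] / r by rewrite -rec mulrAC mulfV// mul1r.
suff -> : - (flat * (yk * (Q t n.+1).[yk] / r)) / (Q t n.+2)^`().[yk] =
  - yk ^+ 2 * flat * r^-1 * (Q t n.+1).[yk] / (yk * (Q t n.+2)^`().[yk]) by [].
have [->|y0] := eqVneq yk 0; first by rewrite expr0n /= !(mul0r, oppr0, mulr0).
rewrite [(yk * _)^-1]invfM; move: (_^`().[yk]^-1) => i; field.
by rewrite y0 r0.
Qed.
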